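(* Let $\mathcal{H}$ be a $d$-dimensional Hilbert space and let $\mathscr{A}$ be a simple POVM on $\mathcal{H}$. Then $$\zeta_\rho(\mathscr{A})=\gamma(\mathscr{A})-1\leq d-1\qquad \forall \rho\in\mathscr{D}(\mathcal{H}),$$ where $\zeta_\rho(\mathscr{A})$ is the sharpness index of $\mathscr{A}$ at $\rho$ and $\gamma(\mathscr{A})$ is the projective index of $\mathscr{A}$. The upper bound is saturated if and only if $\mathscr{A}$ is a rank-1 PVM.
   Context: $\mathcal{H}$ is a complex Hilbert space of finite dimension $d$; $\mathscr{D}(\mathcal{H})$ is the set of positive definite operators of trace 1 on $\mathcal{H}$. POVMs. A POVM on $\mathcal{H}$ is a finite family of positive semidefinite operators on $\mathcal{H}$ summing to the identity. It is rank-1 if all its nonzero elements have rank 1. A PVM is a POVM whose elements are (orthogonal) projectors. A POVM is simple if every pair of its elements is linearly independent and it contains no zero element. The transition graph $G(\mathscr{A})$ of a POVM $\mathscr{A}$ has one vertex for each nonzero element of $\mathscr{A}$, two vertices being adjacent iff the corresponding elements are not orthogonal (Hilbert–Schmidt inner product nonzero, equivalently product nonzero). The elements belonging to a connected component of $G(\mathscr{A})$ form an irreducible component of $\mathscr{A}$. The projective index $\gamma(\mathscr{A})$ is the number of irreducible components. Parametrizations and Fisher information. Near $\rho\in\mathscr{D}(\mathcal{H})$ choose a parametrization $\rho(\theta)\in\mathscr{D}(\mathcal{H})$ by $g=d^2-1$ real parameters $\theta=(\theta_1,\dots,\theta_g)$, differentiable and with linearly independent derivatives $\rho_{,a}:=\partial\rho(\theta)/\partial\theta_a$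 (so they form a basis of the real space of traceless Hermitian operators). For a POVM $\mathscr{A}=\{A_j\}_j$ put $p_j(\theta)=\operatorname{tr}[\rho(\theta)A_j]$. The Fisher information matrix $I(\theta,\mathscr{A})$ has entries $I_{ab}=\sum_{j:A_j\neq0}\frac{1}{p_j}\frac{\partial p_j}{\partial\theta_a}\frac{\partial p_j}{\partial\theta_b}$. The quantum Fisher information matrix $J_{\mathrm S}(\theta)$ has entries $(J_{\mathrm S})_{ab}=\frac12\operatorname{tr}[\rho(L_aL_b+L_bL_a)]$, where $L_a$ is the Hermitian operator determined by $\frac12(\rho L_a+L_a\rho)=\rho_{,a}$. The metric-adjusted Fisher information matrix is $I_{\mathrm S}(\theta,\mathscr{A}):=J_{\mathrm S}^{-1/2}(\theta)\,I(\theta,\mathscr{A})\,J_{\mathrm S}^{-1/2}(\theta)$; its eigenvalues at a given $\rho$ do not depend on the parametrization. The sharpness index $\zeta_\rho(\mathscr{A})$ is the multiplicity of the eigenvalue $1$ of $I_{\mathrm S}(\theta,\mathscr{A})$ at $\rho=\rho(\theta)$. *)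

(* Defs.v *)
From HB Require Import structures.
From mathcomp Require Import all_boot all_order all_algebra.
From mathcomp Require Import sesquilinear spectral.
From mathcomp Require Import all_classical all_reals all_analysis.
From mathcomp Require Import complex.

Set Implicit Arguments.
Unset Strict Implicit.
Unset Printing Implicit Defensive.

Import Order.TTheory GRing.Theory Num.Theory.
Import numFieldNormedType.Exports.

Local Open Scope classical_set_scope.
Local Open Scope ring_scope.
Local Open Scope sesquilinear_scope.
Local Open Scope complex_scope.

(* Operators on the d-dimensional complex Hilbert space are the matrices
   'M[R[i]]_d in an orthonormal basis, for R : realType. *)

(* [theta] is [Num.conj] for complex matrices and [idfun] for real ones. *)
Definition psdmx (F : numFieldType) (theta : {rmorphism F -> F}) (n : nat)
    (M : 'M[F]_n) : Prop :=
  M \is hermitianmx n false theta /\ forall u : 'rV[F]_n, 0 <= form theta M u u.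

Definition pdmx (F : numFieldType) (theta : {rmorphism F -> F}) (n : nat)
    (M : 'M[F]_n) : Prop :=
  M \is hermitianmx n false theta /\
  forall u : 'rV[F]_n, u != 0 -> 0 < form theta M u u.

(* The positive semidefinite square root of a real positive semidefinite matrix
   (it exists and is unique; the value on other matrices is irrelevant). *)
Definition sqrtmx (R : realType) (n : nat) (M : 'M[R]_n) : 'M[R]_n :=
  xget 0 [set K : 'M[R]_n | psdmx idfun K /\ K *m K = M].

Section Operators.
Variables (R : realType) (d : nat).
Local Notation C := R[i].

Definition density (rho : 'M[C]_d) : Prop := pdmx Num.conj rho /\ \tr rho = 1.

Section POVM.
Variables (I : finType) (A : I -> 'M[C]_d).

Definition povm : Prop := (forall j, psdmx Num.conj (A j)) /\ \sum_j A j = 1%:M.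

Definition rank1 : Prop := forall j, A j != 0 -> \rank (A j) = 1%N.

Definition pvm : Prop :=
  povm /\ forall j, A j \is hermsymmx /\ A j *m A j = A j.

Definition simple_povm : Prop :=
  [/\ povm, forall j, A j != 0 & forall j k, j != k -> free [:: A j; A k]].

(* The transition graph. *)
Definition tg_vertex : finType := {j : I | A j != 0}.

Definition tg_adj : rel tg_vertex :=
  fun j k => (j != k) && (\tr ((A (val j)) ^t* *m A (val k)) != 0).

Definition projective_index : nat := n_comp tg_adj predT.

End POVM.

(* Symmetric logarithmic derivative in the direction X: for positive definite
   rho and Hermitian X it exists and is unique. *)
Definition sld (rho X : 'M[C]_d) : 'M[C]_d :=
  xget 0 [set L : 'M[C]_d |
    L \is hermsymmx /\ 2^-1 *: (rho *m L + L *m rho) = X].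

Definition nparam : nat := (d ^ 2 - 1)%N.

Section Parametrized.
Variable rho : 'rV[R]_nparam -> 'M[C]_d.

(* Differentiability and derivatives with respect to the real parameters are
   taken on the real and imaginary parts of the matrix entries. *)
Definition differentiable_family (t : 'rV[R]_nparam) : Prop :=
  forall i j, differentiable (fun s => complex.Re (rho s i j)) t /\
              differentiable (fun s => complex.Im (rho s i j)) t.

Definition pderiv (a : 'I_nparam) (t : 'rV[R]_nparam) : 'M[C]_d :=
  \matrix_(i, j) ('D_('e_a) (fun s => complex.Re (rho s i j)) t
                  +i* 'D_('e_a) (fun s => complex.Im (rho s i j)) t).

Definition independent_pderivs (t : 'rV[R]_nparam) : Prop :=
  forall c : 'I_nparam -> R,
    \sum_a (c a)%:C *: pderiv a t = 0 -> forall a, c a = 0.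

Definition parametrization_near (t : 'rV[R]_nparam) : Prop :=
  \forall s \near t,
    [/\ density (rho s), differentiable_family s & independent_pderivs s].

(* tr[rho A_j] is real for Hermitian arguments, whence the real part;
   likewise in [qfisher]. *)
Definition prob (I : finType) (A : I -> 'M[C]_d) (j : I)
    (t : 'rV[R]_nparam) : R :=
  complex.Re (\tr (rho t *m A j)).

Definition fisher (I : finType) (A : I -> 'M[C]_d) (t : 'rV[R]_nparam) :
    'M[R]_nparam :=
  \matrix_(a, b) \sum_(j | A j != 0)
    (prob A j t)^-1 * 'D_('e_a) (prob A j) t * 'D_('e_b) (prob A j) t.

Definition qfisher (t : 'rV[R]_nparam) : 'M[R]_nparam :=
  \matrix_(a, b)
    let La := sld (rho t) (pderiv a t) in
    let Lb := sld (rho t) (pderiv b t) in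
    complex.Re (2^-1 * \tr (rho t *m (La *m Lb + Lb *m La))).

Definition metric_adjusted_fisher (I : finType) (A : I -> 'M[C]_d)
    (t : 'rV[R]_nparam) : 'M[R]_nparam :=
  let K := invmx (sqrtmx (qfisher t)) in K *m fisher A t *m K.

(* The matrix is symmetric, so the dimension of the eigenspace is also the
   algebraic multiplicity. *)
Definition sharpness_index (I : finType) (A : I -> 'M[C]_d)
    (t : 'rV[R]_nparam) : nat :=
  \rank (eigenspace (metric_adjusted_fisher A t) 1).

End Parametrized.
End Operators.

(* Main.v *)
(* Let L_a be the logarithmic derivatives and ev X = Re tr(rho X).  The adjusted
   Fisher matrix has eigenvalue 1 exactly on the kernel of I - J, and for
   X = sum_a y_a L_a the number y (J - I) y^T is a sum over j of
   tr(rho (X - l_j) A_j (X - l_j)) >= 0 with l_j = ev(X A_j) / ev(A_j).  Hence the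
   kernel consists of the Hermitian X with ev X = 0 and A_j X = l_j A_j for all j.
   If A_j A_k <> 0 then l_j = l_k, so l is constant on the components of the
   transition graph, and X is a real combination of the sums P_i of the elements
   of the components.  These P_i are nonzero projectors, mutually orthogonal and
   summing to 1: they span a space of dimension gamma <= d on which ev X = 0 cuts
   out a hyperplane, and gamma = d forces all P_i to have rank 1, whence each
   component of a simple POVM is a single element. *)

Require Import Defs.
From HB Require Import structures.
From mathcomp Require Import all_boot all_order all_algebra.
From mathcomp Require Import sesquilinear spectral.
From mathcomp Require Import all_classical all_reals all_analysis.
From mathcomp Require Import complex.
From mathcomp Require Import ring lra zify.

Set Implicit Arguments.
Unset Strict Implicit.
Unset Printing Implicit Defensive.

Import Order.TTheory GRing.Theory Num.Theory.
Import numFieldNormedType.Exports.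

Local Open Scope ring_scope.
Local Open Scope complex_scope.

(** * Positive matrices, their square roots and the Lyapunov equation *)

Section ComplexMatrices.
Local Open Scope sesquilinear_scope.
Variable C : numClosedFieldType.

Lemma adjmxM m n p (X : 'M[C]_(m, n)) (Y : 'M[C]_(n, p)) :
  (X *m Y)^t* = Y^t* *m X^t*.
Proof. by rewrite trmx_mul map_mxM. Qed.

Lemma hermsymmxP n (X : 'M[C]_n) : reflect (X^t* = X) (X \is hermsymmx).
Proof.
rewrite is_hermitianmxE expr0 scale1r eq_sym; exact: eqP.
Qed.

Lemma mxtrace_adj n (X : 'M[C]_n) : \tr (X^t*) = (\tr X)^*%R.
Proof. by rewrite rmorph_sum; apply: eq_bigr => i _; rewrite !mxE. Qed.

Lemma mxtrace_congrE m n (N : 'M[C]_(m, n)) (P : 'M[C]_n) :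
  \tr (N *m P *m N^t*) = \sum_i form Num.conj P (row i N) (row i N).
Proof.
apply: eq_bigr => i _; rewrite /form -row_mul !mxE; apply: eq_bigr => j _.
by rewrite !mxE.
Qed.

Lemma mxtrace_congr_ge0 m n (N : 'M[C]_(m, n)) (P : 'M[C]_n) :
  psdmx Num.conj P -> 0 <= \tr (N *m P *m N^t*).
Proof. by move=> [_ P_ge0]; rewrite mxtrace_congrE sumr_ge0. Qed.

Lemma pdmx_psdmx (F : numFieldType) (theta : {rmorphism F -> F}) n
  (P : 'M[F]_n) : pdmx theta P -> psdmx theta P.
Proof.
move=> [hP P_gt0]; split=> // u; have [->|/P_gt0/ltW//] := eqVneq u 0.
by rewrite /form !mul0mx mxE.
Qed.

(** The trace is a sum of nonnegative values of the form of P at the rows of N; each must vanish,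
    and definiteness kills the row. *)
Lemma mxtrace_congr_eq0 m n (N : 'M[C]_(m, n)) (P : 'M[C]_n) :
  pdmx Num.conj P -> \tr (N *m P *m N^t*) = 0 -> N = 0.
Proof.
move=> pdP /eqP; have [_ P_ge0] := pdmx_psdmx pdP.
rewrite mxtrace_congrE psumr_eq0 => [/allP N0|i _]; last exact: P_ge0.
apply/row_matrixP => i; rewrite row0; apply/eqP/negPn/negP => /pdP.2.
by have /eqP -> := N0 i (mem_index_enum _); rewrite ltxx.
Qed.

Lemma pdmx1 n : pdmx Num.conj (1%:M : 'M[C]_n).
Proof.
split; first by apply/hermsymmxP; rewrite trmx1 map_mx1.
by move=> u u0; rewrite /form mulmx1 -dotmxE dotmx_is_dotmx.
Qed.

(** By the spectral theorem: the eigenvalues are values of the form at the rows of the unitary U,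
    hence nonnegative, and their square roots are conjugated back by U. *)
Lemma psdmx_sqrt n (P : 'M[C]_n) : psdmx Num.conj P ->
  exists2 K, psdmx Num.conj K & K *m K = P.
Proof.
move=> [hP P_ge0]; have /hermitian_normalmx/orthomx_spectralP PE := hP.
set U := spectralmx P in PE; set s := spectral_diag P in PE.
have UU : U *m U^t* = 1%:M by apply/unitarymxP/spectral_unitarymx.
rewrite invmx_unitary ?spectral_unitarymx// -/U in PE.
have sE : U *m P *m U^t* = diag_mx s.
  by rewrite PE !mulmxA UU mul1mx -mulmxA UU mulmx1.
have s_ge0 i : 0 <= s 0 i.
  have := P_ge0 (row i U).
  suff -> : form Num.conj P (row i U) (row i U) = s 0 i by [].
  have /matrixP/(_ i i) := sE; rewrite [in RHS]mxE eqxx mulr1n => <-.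
  rewrite /form -row_mul [LHS]mxE [RHS]mxE; apply: eq_bigr => k _.
  by rewrite !mxE.
set r := \row_i sqrtC (s 0 i).
have rr : diag_mx r *m diag_mx r = diag_mx s.
  by rewrite mulmx_diag; congr diag_mx; apply/rowP => i; rewrite !mxE -expr2 sqrtCK.
have r_ge0 i : 0 <= r 0 i by rewrite mxE sqrtC_ge0.
exists (U^t* *m diag_mx r *m U); last first.
  rewrite !mulmxA -(mulmxA _ U) UU mulmx1.
  by rewrite -(mulmxA _ (diag_mx r) (diag_mx r)) rr PE.
split.
  apply/hermsymmxP; rewrite !adjmxM trmxCK mulmxA; congr (_ *m _ *m _).
  rewrite tr_diag_mx map_diag_mx; congr diag_mx; apply/rowP => i.
  by rewrite mxE; apply/CrealP/ger0_real.
move=> u; pose v := u *m U^t*; rewrite /form.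
have -> : u *m (U^t* *m diag_mx r *m U) *m u^t* = v *m diag_mx r *m v^t*.
  by rewrite /v adjmxM trmxCK !mulmxA.
move: v => v; rewrite mxE sumr_ge0// => i _; rewrite mul_mx_diag [X in X * _]mxE.
by rewrite [X in _ * X]mxE [X in _ * X^*%R]mxE mulrAC mulr_ge0 // mul_conjC_ge0.
Qed.

(* tr(L^* (P L + L P)) is a sum of two nonnegative congruences of P by L^* and L. *)
Lemma lyapunov_eq0 n (P L : 'M[C]_n) :
  pdmx Num.conj P -> P *m L + L *m P = 0 -> L = 0.
Proof.
move=> pdP PL0; have psP := pdmx_psdmx pdP.
have : \tr (L *m P *m L^t*) + \tr (L^t* *m P *m L^t*^t*) = 0.
  rewrite trmxCK mxtrace_mulC -(mulmxA _ P) -linearD -mulmxDr /=.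
  by rewrite addrC PL0 mulmx0 mxtrace0.
move/eqP; rewrite paddr_eq0 ?mxtrace_congr_ge0// => /andP[/eqP + _].
exact: mxtrace_congr_eq0.
Qed.

(** [lyapunov_eq0] makes L |-> P L + L P an injective endomorphism of a finite-dimensional space,
    hence a surjective one. *)
Lemma lyapunov_surj n (P X : 'M[C]_n) :
  pdmx Num.conj P -> exists L, P *m L + L *m P = X.
Proof.
move=> pdP; pose f (L : 'M[C]_n) := P *m L + L *m P.
have f_lin : linear f.
  move=> a u v; rewrite /f mulmxDr mulmxDl -scalemxAr -scalemxAl scalerDr.
  by rewrite addrACA.
pose fL := GRing.isLinear.Build _ _ _ _ f f_lin.
pose F : {linear 'M[C]_n -> 'M[C]_n} := HB.pack f fL.
have Fu : row_free (lin_mx F).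
  apply/row_freeP; apply/row_freeP; rewrite -kermx_eq0; apply/eqP.
  apply/row_matrixP => i; rewrite row0.
  have /sub_kermxP := row_sub i (kermx (lin_mx F)).
  rewrite -{1}[row i _]vec_mxK mul_vec_lin => /(canRL mxvecK).
  rewrite linear0 => /(lyapunov_eq0 pdP) /(canRL vec_mxK) ->.
  by rewrite linear0.
exists (vec_mx (mxvec X *m invmx (lin_mx F))).
apply: (can_inj mxvecK); rewrite -[P *m _ + _]/(F _) -mul_vec_lin vec_mxK.
by rewrite mulmxKV // -row_free_unit.
Qed.

(** With P = K K and Q = L L for Hermitian K and L, cyclicity turns the trace of P Q into that of M
    M^* for M = K L, so K L = 0. *)
Lemma psdmx_mul_eq0 n (P Q : 'M[C]_n) : psdmx Num.conj P ->
  psdmx Num.conj Q -> \tr (P *m Q) = 0 -> P *m Q = 0.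
Proof.
move=> /psdmx_sqrt[K [/hermsymmxP hK _] <-] /psdmx_sqrt[L [/hermsymmxP hL _] <-].
have -> : \tr (K *m K *m (L *m L)) = \tr (K *m L *m 1%:M *m (K *m L)^t*).
  by rewrite adjmxM hK hL mulmx1 -!mulmxA mxtrace_mulC !mulmxA.
move/(mxtrace_congr_eq0 (pdmx1 n)) => KL.
by rewrite -!mulmxA (mulmxA K L) KL mul0mx mulmx0.
Qed.

Lemma psdmx_tr_mul_ge0 n (P Q : 'M[C]_n) : psdmx Num.conj P ->
  psdmx Num.conj Q -> 0 <= \tr (P *m Q).
Proof.
move=> psP /psdmx_sqrt[K [/hermsymmxP hK _] <-].
by rewrite mulmxA mxtrace_mulC mulmxA -{2}hK mxtrace_congr_ge0.
Qed.

Lemma pdmx_tr_mul_eq0 n (P Q : 'M[C]_n) : pdmx Num.conj P ->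
  psdmx Num.conj Q -> \tr (P *m Q) = 0 -> Q = 0.
Proof.
move=> pdP /psdmx_sqrt[K [/hermsymmxP hK _] <-].
rewrite mulmxA mxtrace_mulC mulmxA -{2}hK => /(mxtrace_congr_eq0 pdP) ->.
by rewrite mul0mx.
Qed.

Lemma psdmx_congr n m (N : 'M[C]_(m, n)) (P : 'M[C]_n) :
  psdmx Num.conj P -> psdmx Num.conj (N *m P *m N^t*).
Proof.
move=> [/hermsymmxP hP P_ge0]; split.
  by apply/hermsymmxP; rewrite !adjmxM trmxCK hP mulmxA.
move=> u; have := P_ge0 (u *m N).
by rewrite /form adjmxM !mulmxA.
Qed.

(** With P = K K, the product N P N^* is M M^* for M = N K, so N K = 0 already. *)
Lemma psdmx_congr_eq0 m n (N : 'M[C]_(m, n)) (P : 'M[C]_n) :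
  psdmx Num.conj P -> N *m P *m N^t* = 0 -> N *m P = 0.
Proof.
move=> /psdmx_sqrt[K [/hermsymmxP hK _] <-] NP0; rewrite mulmxA.
rewrite (_ : N *m K = 0) ?mul0mx//.
apply: (mxtrace_congr_eq0 (pdmx1 n)).
by rewrite mulmx1 adjmxM hK !mulmxA -(mulmxA N) NP0 mxtrace0.
Qed.

End ComplexMatrices.

(** * Labelling the components of the transition graph *)

Section Components.
Local Open Scope sesquilinear_scope.
Variables (R : realType) (d : nat) (I : finType) (A : I -> 'M[R[i]]_d).

(** The label of j enumerates the root of its component. The last clause is connectedness: what is
    constant along edges is constant on components. It is stated for any type T because it serves
    both for real eigenvalues and for the identity function of I. *)
Lemma transition_components :
  (forall j, A j != 0) -> (forall j, A j \is hermsymmx) ->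
  exists c : I -> 'I_(projective_index A),
  [/\ forall i, exists j, c j = i,
      forall j k, c j != c k -> \tr (A j *m A k) = 0
    & forall (T : Type) (f : I -> T),
        (forall j k, \tr (A j *m A k) != 0 -> f j = f k) ->
        forall j k, c j = c k -> f j = f k].
Proof.
move=> A0 hA; set e := @tg_adj R d I A.
pose V j : tg_vertex A := Sub j (A0 j).
have eE j k : e (V j) (V k) = (V j != V k) && (\tr (A j *m A k) != 0).
  by rewrite /e /tg_adj !SubK (hermsymmxP _ (hA j)).
have e_sym : symmetric e.
  move=> x y; have -> : x = V (val x) by apply: val_inj; rewrite SubK.
  have -> : y = V (val y) by apply: val_inj; rewrite SubK.
  by rewrite !eE eq_sym mxtrace_mulC.
have e_csym : connect_sym e by exact: sym_connect_sym.
(* This is the predicate that [n_comp] counts, so [gE] below holds by conversion. *)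
pose B := predI (roots e) (mem (predT : pred (tg_vertex A))).
have rootB x : fingraph.root e x \in B by rewrite !inE andbT; exact: roots_root.
have gE : #|B| = projective_index A by [].
pose c0 j : 'I_#|B| := enum_rank_in (rootB (V j)) (fingraph.root e (V j)).
have c0E j k : (c0 j == c0 k) = connect e (V j) (V k).
  rewrite -(root_connect e_csym); apply/eqP/eqP => [cjk|rjk].
    rewrite -(enum_rankK_in (rootB (V j)) (rootB (V j))) -/(c0 j) cjk.
    by rewrite enum_rankK_in.
  by apply: enum_val_inj; rewrite !enum_rankK_in ?rootB // rjk.
exists (fun j => cast_ord gE (c0 j)); split.
- move=> i; pose x := enum_val (cast_ord (esym gE) i).
  have : x \in B by exact: enum_valP.
  rewrite !inE andbT => /eqP rx; exists (val x).
  apply: (@cast_ord_inj _ _ (esym gE)); rewrite cast_ordK; apply: enum_val_inj.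
  have Vx : V (val x) = x by apply: val_inj; rewrite SubK.
  by rewrite enum_rankK_in ?rootB // Vx rx.
- move=> j k; rewrite (inj_eq (@cast_ord_inj _ _ gE)) c0E => njk.
  apply/eqP; apply: contraR njk => jk0.
  have [->|Vjk] := eqVneq (V j) (V k); first exact: connect0.
  by apply: connect1; rewrite eE Vjk.
- move=> T f ef j k /cast_ord_inj/eqP; rewrite c0E => /connectP[p].
  have -> : f j = f (val (V j)) by rewrite SubK.
  have -> : f k = f (val (V k)) by rewrite SubK.
  move: (V j) (V k) => x y; elim: p x => [|z p IHp] x /= => [_ -> //|].
  move=> /andP[exz /IHp H /H <-]; apply: ef.
  case/andP: exz => _.
  by rewrite (hermsymmxP _ (hA _)).
Qed.

End Components.

(** * Sums over components: orthogonal idempotents and their ranks *)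

Section Blocks.
Local Open Scope sesquilinear_scope.
Variables (C : numClosedFieldType) (d g : nat) (I : finType).
Variables (A : I -> 'M[C]_d) (c : I -> 'I_g).
Hypotheses (psdA : forall j, psdmx Num.conj (A j)) (sumA : \sum_j A j = 1%:M).
Hypothesis c_surj : forall i, exists j, c j = i.
Hypothesis c_orth : forall j k, c j != c k -> \tr (A j *m A k) = 0.
Hypothesis A0 : forall j, A j != 0.

Definition block (i : 'I_g) : 'M[C]_d := \sum_(j | c j == i) A j.

Lemma block_orth j k : c j != c k -> A j *m A k = 0.
Proof. by move=> /c_orth; exact: psdmx_mul_eq0. Qed.

Lemma sum_block : \sum_i block i = 1%:M.
Proof.
by rewrite -sumA (partition_big c predT).
Qed.

(** A block of another component annihilates A_j; since the blocks sum to 1, the block of j itself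
    must act on A_j as the identity. *)
Lemma mul_block_r j i : A j *m block i = (A j) *+ (c j == i).
Proof.
have orth_r i' : c j != i' -> A j *m block i' = 0.
  by move=> ji; rewrite mulmx_sumr big1// => k /eqP ck; rewrite block_orth// ck.
have [<-|/orth_r//] := eqVneq (c j) i; rewrite mulr1n.
rewrite -[RHS]mulmx1 -sum_block [in RHS]mulmx_sumr.
rewrite [in RHS](bigD1 (c j))//= [X in _ = _ + X]big1 ?addr0//.
by move=> i' ji; rewrite orth_r // eq_sym.
Qed.

Lemma mul_block_l j i : block i *m A j = (A j) *+ (c j == i).
Proof.
have orth_r i' : c j != i' -> block i' *m A j = 0.
  move=> ji; rewrite mulmx_suml big1// => k /eqP ck.
  by rewrite block_orth// ck eq_sym.
have [<-|/orth_r//] := eqVneq (c j) i; rewrite mulr1n.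
rewrite -[RHS]mul1mx -sum_block [in RHS]mulmx_suml.
rewrite [in RHS](bigD1 (c j))//= [X in _ = _ + X]big1 ?addr0//.
by move=> i' ji; rewrite orth_r // eq_sym.
Qed.

Lemma mul_block i i' : block i *m block i' = (block i) *+ (i == i').
Proof.
rewrite {1}/block mulmx_suml (eq_bigr (fun j => A j *+ (i == i'))).
  by rewrite -sumrMnl.
by move=> j /eqP <-; rewrite mul_block_r.
Qed.

Lemma block_neq0 i : block i != 0.
Proof.
have [j <-] := c_surj i; apply: contraNneq (A0 j) => b0.
by have := mul_block_r j (c j); rewrite eqxx b0 mulmx0 mulr1n => <-.
Qed.

(** The row spaces of the blocks are in direct sum, since block i fixes its own row space and kills
    the others; they fill the whole space because the blocks sum to 1. *)
Lemma sum_rank_block : (\sum_i \rank (block i) = d)%N.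
Proof.
have dx : mxdirect (\sum_i block i).
  apply/mxdirect_sumsP => i _; apply/eqP; rewrite -submx0.
  apply/rV_subP => u; rewrite sub_capmx => /andP[/submxP[v ->]].
  move=> /(submxMr (block i)); rewrite -mulmxA mul_block eqxx mulr1n.
  move/submx_trans; apply; rewrite sumsmxMr_gen; apply/sumsmx_subP => k ki.
  by rewrite genmxE mul_block (negPf ki) mulr0n.
move/mxdirectP : dx => /= <-; rewrite -[RHS](mxrank1 C); apply: eqmx_rank.
apply/andP; split; first exact: submx1.
by rewrite -sum_block summx_sub// => i _; exact: sumsmx_sup (submx_refl _).
Qed.

Lemma blocks_le : (g <= d)%N.
Proof.
rewrite -sum_rank_block -[X in (X <= _)%N]card_ord -sum1_card leq_sum// => i _.
by rewrite lt0n mxrank_eq0 block_neq0.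
Qed.

(** The g = d ranks are all at least 1 and sum to d. *)
Lemma blocks_rank1 : g = d -> forall i, \rank (block i) = 1%N.
Proof.
move=> gd i; apply/eqP; rewrite eqn_leq lt0n mxrank_eq0 block_neq0 andbT.
have := sum_rank_block; rewrite (bigD1 i)//= => sumd.
rewrite -(leq_add2r (\sum_(k < g | k != i) \rank (block k))) sumd.
rewrite -{1}gd -[X in (X <= _)%N]card_ord -sum1_card (bigD1 i)//= leq_add2l.
by apply: leq_sum => k _; rewrite lt0n mxrank_eq0 block_neq0.
Qed.

(** P factors as a column x times a row y, and y X x is a scalar. *)
Lemma rank1_sandwich (P X : 'M[C]_d) :
  \rank P = 1%N -> exists s, P *m X *m P = s *: P.
Proof.
move=> rP; rewrite -(mulmx_base P); move: (col_base P) (row_base P).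
rewrite rP => x y; exists ((y *m X *m x) 0 0).
by rewrite scalemxAl -mul_mx_scalar -mx11_scalar !mulmxA.
Qed.

(** A_j equals P_i A_j P_i, to which [rank1_sandwich] applies. *)
Lemma block_rank1_proportional i j : c j = i -> \rank (block i) = 1%N ->
  exists s, A j = s *: block i.
Proof.
move=> cj /(@rank1_sandwich _ (A j))[s]; rewrite mul_block_l cj eqxx mulr1n.
by rewrite mul_block_r cj eqxx mulr1n; exists s.
Qed.

(** Two elements of one component would be multiples of the same rank-1 block, against their linear
    independence. *)
Lemma blocks_full_inj : g = d ->
  (forall j k, j != k -> free [:: A j; A k]) -> injective c.
Proof.
move=> gd Afree j k cjk; apply/eqP/negPn/negP => /[dup] jk /Afree.
have r1 := blocks_rank1 gd (c j).
have [s As] := block_rank1_proportional erefl r1.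
have [t At] := block_rank1_proportional (esym cjk) r1.
have t0 : t != 0 by apply: contraNneq (A0 k) => t0; rewrite At t0 scale0r.
rewrite free_cons span_seq1 => /andP[/negP]; case.
by apply/vlineP; exists (s / t); rewrite As At scalerA divfK.
Qed.

Lemma block_inj j : injective c -> block (c j) = A j.
Proof.
move=> c_inj; rewrite /block (bigD1 j)//= big1 ?addr0// => k /andP[/eqP/c_inj->].
by rewrite eqxx.
Qed.

End Blocks.

(** * Real matrices inside complex ones, and the real square root *)

Lemma mulmx_rect (K : comNzRingType) n (i : K) (M : 'M[K]_n) (x y : 'rV[K]_n)
    (x' y' : 'cV[K]_n) :
  (x + i *: y) *m M *m (x' - i *: y') =
  x *m M *m x' - i *: (x *m M *m y') +
  (i *: (y *m M *m x') - (i * i) *: (y *m M *m y')).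
Proof.
by rewrite !mulmxDl !mulmxBr -!scalemxAr -!scalemxAl scalerA.
Qed.

Section RealSquareRoot.
Local Open Scope sesquilinear_scope.
Variable R : realType.
Local Notation C := R[i].
Local Notation toC := (map_mx (real_complex R)).

Lemma conj_toC m n (X : 'M[R]_(m, n)) : map_mx Num.conj (toC X) = toC X.
Proof. by apply/matrixP => i j; rewrite !mxE; exact: conjc_real. Qed.

Lemma adj_toC m n (X : 'M[R]_(m, n)) : (toC X)^t* = toC X^T.
Proof. by rewrite -[RHS]conj_toC map_trmx. Qed.

Lemma ReD (x y : C) : complex.Re (x + y) = complex.Re x + complex.Re y.
Proof. by case: x y => [a b] [c e]. Qed.

Lemma Re_sum (T : Type) (r : seq T) (P : pred T) (f : T -> C) :
  complex.Re (\sum_(i <- r | P i) f i) = \sum_(i <- r | P i) complex.Re (f i).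
Proof. exact: (big_morph _ ReD). Qed.

Lemma ReZ (a : R) (x : C) : complex.Re (a%:C * x) = a * complex.Re x.
Proof. by case: x => [b c]; rewrite /= mul0r subr0. Qed.

Lemma Re_conj (x : C) : complex.Re (x^*%R) = complex.Re x.
Proof. by case: x. Qed.

(** For u = a + i b with a and b real, symmetry of J cancels the mixed terms: the form at u is the
    sum of the forms at a and at b, one of which is nonzero. *)
Lemma pdmx_toC n (J : 'M[R]_n) : pdmx idfun J -> pdmx Num.conj (toC J).
Proof.
move=> [hJ J_gt0].
have JT : J^T = J.
  apply/esym; move: hJ; rewrite is_hermitianmxE expr0 scale1r => /eqP {1}->.
  by apply/matrixP => i j; rewrite !mxE.
split; first by apply/hermsymmxP; rewrite adj_toC JT.
move=> u u0; pose a := map_mx (@complex.Re R) u; pose b := map_mx (@complex.Im R) u.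
have uE : u = toC a + 'i%C *: toC b.
  by apply/rowP => k; rewrite !mxE -complexE.
have uEc : u^t* = toC a^T - 'i%C *: toC b^T.
  apply/matrixP => k l; rewrite !mxE; case: (u _ _) => x y /=.
  by apply/eqP; rewrite eq_complex; simpc.
have ba : b *m J *m a^T = a *m J *m b^T.
  transitivity (a *m J *m b^T)^T; first by rewrite !trmx_mul JT trmxK mulmxA.
  by apply/matrixP => k l; rewrite !ord1 [LHS]mxE.
rewrite /form.
have -> : u *m toC J *m u^t* = toC (a *m J *m a^T + b *m J *m b^T).
  rewrite uEc {1}uE mulmx_rect -!map_mxM ba -expr2 sqr_i scaleN1r opprK map_mxD.
  by rewrite addrA subrK.
rewrite mxE -[0]/(0%:C) ltcR mxE.
have fE (v : 'rV[R]_n) : (v *m J *m v^T) 0 0 = form idfun J v v.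
  by rewrite /form; congr ((_ *m _) _ _); apply/matrixP => k l; rewrite !mxE.
have J_ge0 v : 0 <= form idfun J v v.
  exact: (pdmx_psdmx (conj hJ J_gt0)).2.
rewrite !fE.
have [a0|a0] := eqVneq a 0; last by rewrite ltr_pwDl ?J_gt0.
have b0 : b != 0.
  by apply: contraNneq u0 => b0; rewrite uE a0 b0 !map_mx0 scaler0 addr0.
by rewrite ltr_wpDl ?J_gt0.
Qed.

Lemma psdmx_conj n (K : 'M[C]_n) :
  psdmx Num.conj K -> psdmx Num.conj (map_mx Num.conj K).
Proof.
move=> [/hermsymmxP hK K_ge0]; split.
  by apply/hermsymmxP; rewrite -{2}hK map_trmx.
move=> u; pose v := map_mx Num.conj u.
have : 0 <= (form Num.conj K v v)^*%R by rewrite conjC_ge0.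
suff -> : (form Num.conj K v v)^*%R =
  form Num.conj (map_mx Num.conj K) u u by [].
rewrite /form /v.
transitivity
  ((map_mx Num.conj (map_mx Num.conj u *m K *m (map_mx Num.conj u)^t*)) 0 0).
  by rewrite [RHS]mxE.
by rewrite !map_mxM !map_mxCK map_trmx.
Qed.

(** If the form of K vanished at u, then u K = 0 and the form of K K would vanish there too. *)
Lemma psdmx_sqr_pd n (K : 'M[C]_n) : psdmx Num.conj K ->
  pdmx Num.conj (K *m K) -> pdmx Num.conj K.
Proof.
move=> psK [_ KK_gt0]; split; first exact: psK.1.
move=> u u0; rewrite lt_neqAle psK.2 andbT eq_sym; apply: contraTneq (KK_gt0 u u0).
move=> K0; have : u *m K *m u^t* = 0.
  by apply/matrixP => i j; rewrite !ord1 [LHS]K0 mxE.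
by move/(psdmx_congr_eq0 psK) => uK; rewrite /form mulmxA uK !mul0mx mxE ltxx.
Qed.

Lemma pdmxD n (K L : 'M[C]_n) : pdmx Num.conj K -> pdmx Num.conj L ->
  pdmx Num.conj (K + L).
Proof.
move=> [/hermsymmxP hK K_gt0] [/hermsymmxP hL L_gt0]; split.
  by apply/hermsymmxP; rewrite linearD map_mxD hK hL.
move=> u u0; rewrite /form mulmxDr mulmxDl mxE addr_gt0 //.
  exact: K_gt0.
exact: L_gt0.
Qed.

(* The complex square root K of a real matrix is real: K and its entrywise
   conjugate K' have the same square, so D = K - K' solves
   (K + K') D + D (K + K') = 0. *)
Lemma sqrtmxK n (J : 'M[R]_n) : pdmx idfun J -> sqrtmx J *m sqrtmx J = J.
Proof.
(* In the default case of [xget] no real root exists; the rest of the proof refutes this by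
   producing one. *)
move=> /pdmx_toC pdJ; rewrite /sqrtmx; case: xgetP => [K _ [] //|/= noK].
have [K psK KK] := psdmx_sqrt (pdmx_psdmx pdJ).
have KK' : map_mx Num.conj K *m map_mx Num.conj K = toC J.
  by rewrite -map_mxM KK conj_toC.
have pdK : pdmx Num.conj K by apply: (psdmx_sqr_pd psK); rewrite KK.
have pdK' : pdmx Num.conj (map_mx Num.conj K).
  by apply: (psdmx_sqr_pd (psdmx_conj psK)); rewrite KK'.
have K_real : map_mx Num.conj K = K.
  apply/esym/subr0_eq/(lyapunov_eq0 (pdmxD pdK pdK')).
  rewrite mulmxBr mulmxBl !mulmxDl !mulmxDr KK KK'.
  move: (toC J) (K *m _) (_ *m K) => X Y Z.
  rewrite [X + Z]addrC [Y + X]addrC addrKA [X + Y]addrC [Z + X]addrC addrKA.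
  by rewrite addrA subrK subrr.
pose S := map_mx (@complex.Re R) K.
have SE : toC S = K.
  apply/matrixP => i j; rewrite !mxE; apply: RRe_real; apply/CrealP.
  by rewrite -[in RHS]K_real mxE.
have [hK K_ge0] := psK.
case: (noK S); split; last first.
  by apply: (@map_mx_inj _ _ (real_complex R)); rewrite map_mxM SE.
split.
  rewrite is_hermitianmxE expr0 scale1r; apply/eqP.
  apply: (@map_mx_inj _ _ (real_complex R)); rewrite SE.
  rewrite -[LHS](hermsymmxP _ hK) -{1}SE adj_toC.
  by apply/matrixP => i j; rewrite !mxE.
move=> u; rewrite -ler0c.
have -> : (form idfun S u u)%:C = form Num.conj K (toC u) (toC u); last exact: K_ge0.
rewrite /form adj_toC -SE -!map_mxM [RHS]mxE; congr ((_ *m _) _ _)%:C.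
by apply/matrixP => i j; rewrite !mxE.
Qed.

End RealSquareRoot.

(** * Real coordinates on Hermitian matrices *)

Lemma row_free_ker (F : fieldType) m n (M : 'M[F]_(m, n)) :
  (forall v : 'rV_m, v *m M = 0 -> v = 0) -> row_free M.
Proof.
move=> M_inj; rewrite -kermx_eq0; apply/rowV0P => v.
by move/sub_kermxP; exact: M_inj.
Qed.

Section HermitianCoordinates.
Local Open Scope sesquilinear_scope.
Variables (R : realType) (d : nat).
Local Notation C := R[i].

Lemma ImD (x y : C) : complex.Im (x + y) = complex.Im x + complex.Im y.
Proof. by case: x y => [a b] [c e]. Qed.

Lemma Im_sum (T : Type) (r : seq T) (P : pred T) (f : T -> C) :
  complex.Im (\sum_(i <- r | P i) f i) = \sum_(i <- r | P i) complex.Im (f i).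
Proof. exact: (big_morph _ ImD). Qed.

Lemma ImZ (a : R) (x : C) : complex.Im (a%:C * x) = a * complex.Im x.
Proof. by case: x => [b c]; rewrite /= mul0r addr0. Qed.

Definition real_comb n (y : 'rV[R]_n) (M : 'I_n -> 'M[C]_d) : 'M[C]_d :=
  \sum_a (y 0 a)%:C *: M a.

(* Re X + Im X identifies Hermitian complex matrices with arbitrary real ones:
   its symmetric and antisymmetric parts are Re X and Im X. *)
Definition herm_vec (X : 'M[C]_d) : 'rV[R]_(d * d) :=
  mxvec (\matrix_(i, j) (complex.Re (X i j) + complex.Im (X i j))).

Definition herm_rows n (M : 'I_n -> 'M[C]_d) : 'M[R]_(n, d * d) :=
  \matrix_a herm_vec (M a).

Lemma real_comb_herm n y (M : 'I_n -> 'M[C]_d) :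
  (forall a, (M a)^t* = M a) -> (real_comb y M)^t* = real_comb y M.
Proof.
move=> hM; apply/matrixP => i j; rewrite !mxE !summxE rmorph_sum.
apply: eq_bigr => a _; rewrite !mxE rmorphM; congr (_ * _).
  exact: conjc_real.
by rewrite -[in RHS]hM !mxE.
Qed.

Lemma herm_vec_comb n (y : 'rV[R]_n) (M : 'I_n -> 'M[C]_d) :
  herm_vec (real_comb y M) = y *m herm_rows M.
Proof.
apply: (can_inj vec_mxK); rewrite mxvecK; apply/matrixP => i j.
rewrite mxE mulmx_sum_row linear_sum !summxE Re_sum Im_sum -big_split /=.
apply: eq_bigr => a _; rewrite rowK linearZ /= mxvecK !mxE ReZ ImZ.
by rewrite mulrDr.
Qed.

Lemma herm_vec_inj (X Y : 'M[C]_d) : X^t* = X -> Y^t* = Y ->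
  herm_vec X = herm_vec Y -> X = Y.
Proof.
move=> hX hY /(can_inj mxvecK)/matrixP XY; apply/matrixP => i j.
have := XY i j; have := XY j i; rewrite !mxE.
rewrite -{1 2}hX -{1 2}hY !mxE.
case: (X i j) (Y i j) => [a b] [a' b'] /= e1 e2.
by apply/eqP; rewrite eq_complex /=; apply/andP; split; apply/eqP; lra.
Qed.

(** Real combinations of Hermitian matrices are Hermitian, where [herm_vec] is injective; so
    independence over the reals passes to the coordinate rows. *)
Lemma herm_rows_free n (M : 'I_n -> 'M[C]_d) : (forall a, (M a)^t* = M a) ->
  (forall y, real_comb y M = 0 -> y = 0) -> row_free (herm_rows M).
Proof.
move=> hM M_free; apply: row_free_ker => y; rewrite -herm_vec_comb => y0.
apply: M_free; apply: herm_vec_inj; first exact: real_comb_herm.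
  by rewrite trmx0 map_mx0.
rewrite y0; apply: (can_inj vec_mxK); rewrite mxvecK linear0.
by apply/matrixP => i j; rewrite !mxE /= addr0.
Qed.

End HermitianCoordinates.

(** * Expectations in the state rho and equality of the two informations *)

Section Information.
Local Open Scope sesquilinear_scope.
Variables (R : realType) (d : nat) (rho : 'M[R[i]]_d).
Local Notation C := R[i].
Hypotheses (pd_rho : pdmx Num.conj rho) (tr_rho : \tr rho = 1).

Let herm_rho : rho^t* = rho. Proof. by apply/hermsymmxP; case: pd_rho. Qed.

(** On a product of Hermitian X and Y the real part performs the symmetrization: the value is tr(rho
    (X Y + Y X)) / 2, an inner product when rho is positive definite. *)
Definition expectation (X : 'M[C]_d) : R := complex.Re (\tr (rho *m X)).

Local Notation ev := expectation.

Lemma expectationD X Y : ev (X + Y) = ev X + ev Y.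
Proof. by rewrite /ev mulmxDr mxtraceD ReD. Qed.

Lemma expectationZ a X : ev (a%:C *: X) = a * ev X.
Proof. by rewrite /ev -scalemxAr mxtraceZ ReZ. Qed.

Lemma expectationB X Y : ev (X - Y) = ev X - ev Y.
Proof.
by rewrite -[Y in LHS]scale1r -scaleNr -[1]/(1%:C) -rmorphN expectationD
  expectationZ mulN1r.
Qed.

Lemma expectation_sum (T : finType) (P : pred T) (X : T -> 'M[C]_d) :
  ev (\sum_(i | P i) X i) = \sum_(i | P i) ev (X i).
Proof. by rewrite /ev mulmx_sumr [X in complex.Re X]raddf_sum Re_sum. Qed.

Lemma expectationC X Y : X^t* = X -> Y^t* = Y -> ev (X *m Y) = ev (Y *m X).
Proof.
move=> hX hY; rewrite /ev -Re_conj -mxtrace_adj !adjmxM hX hY herm_rho.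
by rewrite mxtrace_mulC.
Qed.

Lemma expectation_psd_ge0 X : psdmx Num.conj X -> 0 <= ev X.
Proof.
move=> /(psdmx_tr_mul_ge0 (pdmx_psdmx pd_rho)).
by rewrite lecE => /andP[_].
Qed.

Lemma expectation_psd_eq0 X : psdmx Num.conj X -> ev X = 0 -> X = 0.
Proof.
move=> psX evX; apply: (pdmx_tr_mul_eq0 pd_rho psX); apply/eqP.
have := psdmx_tr_mul_ge0 (pdmx_psdmx pd_rho) psX.
by rewrite lecE eq_complex => /andP[/eqP -> _]; rewrite -/(ev X) evX !eqxx.
Qed.

Section Measurement.
Variables (I : finType) (A : I -> 'M[C]_d).
Hypotheses (psdA : forall j, psdmx Num.conj (A j)) (sumA : \sum_j A j = 1%:M).
Hypothesis A0 : forall j, A j != 0.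

Let hermA j : (A j)^t* = A j. Proof. by apply/hermsymmxP; case: (psdA j). Qed.

Lemma expectation_gt0 j : 0 < ev (A j).
Proof.
rewrite lt_neqAle expectation_psd_ge0 // andbT eq_sym.
by apply: contraNneq (A0 j) => /(expectation_psd_eq0 (psdA j)) ->.
Qed.

(** When X is the logarithmic derivative along a parameter, this is the derivative of log p_j, the
    classical score. *)
Definition score j X : R := ev (X *m A j) / ev (A j).

(* With l_j = score j X, summing the nonnegative numbers
   tr(rho (X - l_j) A_j (X - l_j)) over j gives ev (X^2) minus the left-hand side. *)
Lemma information_saturated (X : 'M[C]_d) : X^t* = X ->
  \sum_j (ev (A j))^-1 * ev (X *m A j) * ev (X *m A j) = ev (X *m X) ->
  forall j, A j *m X = (score j X)%:C *: A j.
Proof.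
move=> hX satX.
pose N j := X - (score j X)%:C%:M.
have hN j : (N j)^t* = N j.
  rewrite /N linearB map_mxB hX /= tr_scalar_mx map_scalar_mx; congr (_ - _%:M).
  exact: conjc_real.
pose V j := N j *m A j *m (N j)^t*.
have psV j : psdmx Num.conj (V j) by exact: psdmx_congr.
have evV j : ev (V j) =
    ev (X *m A j *m X) - (ev (A j))^-1 * ev (X *m A j) * ev (X *m A j).
  rewrite /V hN /N mulmxBr !mulmxBl mul_scalar_mx !mul_mx_scalar -scalemxAl.
  rewrite !expectationB !expectationZ [ev (A j *m X)]expectationC //.
  rewrite -/(ev (X *m A j)) /score.
  have : ev (A j) != 0 by rewrite gt_eqF ?expectation_gt0.
  by move: (ev (A j)) (ev (X *m A j)) => p q p0; field.
have sumV : \sum_j ev (V j) = 0.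
  rewrite (eq_bigr _ (fun j _ => evV j)) sumrB satX -expectation_sum.
  by rewrite -mulmx_suml -mulmx_sumr sumA mulmx1 subrr.
move=> j; have /eqP : \sum_j ev (V j) = 0 by [].
rewrite psumr_eq0 => [/allP/(_ j (mem_index_enum _))/eqP evV0|k _]; last first.
  exact: expectation_psd_ge0.
(* Faithfulness of rho gives V_j = 0, hence (X - l_j) A_j = 0, whose adjoint is the claim. *)
have /(psdmx_congr_eq0 (psdA j)) : V j = 0 by exact: expectation_psd_eq0.
move/(congr1 (fun Z => Z^t*)); rewrite adjmxM hN hermA trmx0 map_mx0.
by rewrite /N mulmxBr mul_mx_scalar => /subr0_eq.
Qed.

(** * The kernel of the difference of the information matrices and its dimension *)

Section Count.
Variables (n g : nat) (L : 'I_n -> 'M[C]_d) (c : I -> 'I_g).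
Hypotheses (hermL : forall a, (L a)^t* = L a).
Hypothesis (trL : forall a, ev (L a) = 0).
Hypothesis (L_free : forall y, real_comb y L = 0 -> y = 0).
Hypothesis (dimL : (n + 1 = d * d)%N).
Hypothesis c_surj : forall i, exists j, c j = i.
Hypothesis c_orth : forall j k, c j != c k -> \tr (A j *m A k) = 0.
Hypothesis c_conn : forall (T : Type) (f : I -> T),
  (forall j k, \tr (A j *m A k) != 0 -> f j = f k) ->
  forall j k, c j = c k -> f j = f k.

(** This and the next matrix are the two Fisher matrices written through the logarithmic derivatives
    L_a: the derivative of p_j along a is [ev (L a *m A j)]. *)
Definition quantum_info : 'M[R]_n := \matrix_(a, b) ev (L a *m L b).
Definition classical_info : 'M[R]_n :=
  \matrix_(a, b) \sum_j (ev (A j))^-1 * ev (L a *m A j) * ev (L b *m A j).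

Local Notation P := (block A c).

Lemma expectation_comb_l y Y :
  ev (real_comb y L *m Y) = \sum_a y 0 a * ev (L a *m Y).
Proof.
rewrite /real_comb mulmx_suml expectation_sum; apply: eq_bigr => a _.
by rewrite -scalemxAl expectationZ.
Qed.

Lemma mul_quantum_info y b :
  (y *m quantum_info) 0 b = ev (real_comb y L *m L b).
Proof.
by rewrite mxE expectation_comb_l; apply: eq_bigr => a _; rewrite mxE.
Qed.

Lemma mul_classical_info y b : (y *m classical_info) 0 b =
  \sum_j (ev (A j))^-1 * ev (real_comb y L *m A j) * ev (L b *m A j).
Proof.
rewrite mxE; under eq_bigr do rewrite mxE mulr_sumr.
rewrite exchange_big; apply: eq_bigr => j _ /=.
rewrite expectation_comb_l mulr_sumr mulr_suml; apply: eq_bigr => a _.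
by rewrite !mulrA [y 0 a * _]mulrC.
Qed.

(** The form at y is ev(X X) for X = sum_a y_a L_a; it vanishes only for X = 0, that is y = 0 by
    independence. *)
Lemma quantum_info_pd : pdmx idfun quantum_info.
Proof.
split.
  rewrite is_hermitianmxE expr0 scale1r; apply/eqP/matrixP => a b.
  by rewrite !mxE /= expectationC.
move=> y y0; set X := real_comb y L.
have hX : X^t* = X by exact: real_comb_herm.
have -> : form idfun quantum_info y y = ev (X *m X).
  rewrite /form mxE [in RHS]expectation_comb_l; apply: eq_bigr => a _.
  by rewrite mul_quantum_info !mxE expectationC // mulrC.
have psXX : psdmx Num.conj (X *m X).
  by rewrite -[X in X *m _]mulmx1 -{2}hX; apply/psdmx_congr/pdmx_psdmx/pdmx1.
rewrite lt_neqAle expectation_psd_ge0 // andbT eq_sym.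
apply: contraNneq y0 => /(expectation_psd_eq0 psXX) XX0.
apply/eqP/L_free; rewrite -/X; apply: (mxtrace_congr_eq0 (pdmx1 _ _)).
by rewrite mulmx1 hX XX0 mxtrace0.
Qed.

(** Pairing the kernel equation with y itself gives the equality assumed by [information_saturated].
    Conversely X = sum_j l_j A_j, and both matrices send y to the row with entries sum_j l_j ev(L_b
    A_j). *)
Lemma ker_infoP y : y *m (classical_info - quantum_info) = 0 <->
  exists l : I -> R, forall j, A j *m real_comb y L = (l j)%:C *: A j.
Proof.
set X := real_comb y L; have hX : X^t* = X by exact: real_comb_herm.
have kerE b : (y *m (classical_info - quantum_info)) 0 b =
    \sum_j (ev (A j))^-1 * ev (X *m A j) * ev (L b *m A j) - ev (X *m L b).
  by rewrite mulmxBr mxE mul_classical_info mxE mul_quantum_info.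
split=> [y0|[l AX]].
  exists (fun j => score j X); apply: information_saturated => //.
  have -> : ev (X *m X) = \sum_b y 0 b * ev (X *m L b).
    rewrite expectation_comb_l; apply: eq_bigr => b _.
    by rewrite expectationC.
  have lE j : ev (X *m A j) = \sum_b y 0 b * ev (L b *m A j).
    exact: expectation_comb_l.
  under eq_bigr do rewrite [X in _ * X]lE mulr_sumr.
  rewrite exchange_big; apply: eq_bigr => b _ /=.
  have /rowP/(_ b) := y0; rewrite kerE mxE => /subr0_eq <-.
  by rewrite mulr_sumr; apply: eq_bigr => j _; rewrite mulrCA.
have XA j : X *m A j = (l j)%:C *: A j.
  move: (AX j) => /(congr1 (fun Z => Z^t*)); rewrite adjmxM hX hermA => ->.
  rewrite linearZ map_mxZ hermA; congr (_ *: _); exact: conjc_real.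
apply/rowP => b; rewrite kerE mxE; apply/eqP; rewrite subr_eq0; apply/eqP.
have -> : X *m L b = \sum_j (l j)%:C *: (A j *m L b).
  rewrite -[X]mulmx1 -sumA mulmx_sumr mulmx_suml; apply: eq_bigr => j _.
  by rewrite XA scalemxAl.
rewrite expectation_sum; apply: eq_bigr => j _.
rewrite XA !expectationZ [in RHS]expectationC //.
have : ev (A j) != 0 by rewrite gt_eqF ?expectation_gt0.
by move: (ev (A j)) (ev (L b *m A j)) => p q p0; field.
Qed.

Lemma mul_comb_block j z :
  A j *m real_comb z P = (z 0 (c j))%:C *: A j.
Proof.
rewrite /real_comb mulmx_sumr (bigD1 (c j)) //= big1 ?addr0.
  by rewrite -scalemxAr mul_block_r // eqxx.
by move=> i ij; rewrite -scalemxAr mul_block_r // eq_sym (negPf ij) scaler0.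
Qed.

(** Evaluating tr(A_j X A_k) from either side gives l_j = l_k along edges, hence on components; then
    X = sum_j A_j X = sum_j l_j A_j is grouped by component. *)
Lemma eigen_comb_block X (l : I -> R) : X^t* = X ->
  (forall j, A j *m X = (l j)%:C *: A j) -> exists z, X = real_comb z P.
Proof.
move=> hX AX.
have XA j : X *m A j = (l j)%:C *: A j.
  move: (AX j) => /(congr1 (fun Z => Z^t*)); rewrite adjmxM hX hermA => ->.
  rewrite linearZ map_mxZ hermA; congr (_ *: _); exact: conjc_real.
have l_conn j k : c j = c k -> l j = l k.
  apply: c_conn => {}j {}k; apply: contraNeq => l_neq.
  have : (l j)%:C *: \tr (A j *m A k) = (l k)%:C *: \tr (A j *m A k).
    by rewrite /GRing.scale /= -!mxtraceZ scalemxAl -AX -mulmxA XA scalemxAr.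
  move/eqP; rewrite -subr_eq0 -scalerBl scaler_eq0 subr_eq0 => /orP[|//].
  by move=> /eqP/complexI/eqP; rewrite (negPf l_neq).
(* One representative per component; its eigenvalue is the coefficient of the block. *)
pose s i := sval (cid (c_surj i)).
have cs i : c (s i) = i by exact: (svalP (cid (c_surj i))).
exists (\row_i l (s i)).
rewrite -[LHS]mul1mx -sumA mulmx_suml (partition_big c predT) //=.
apply: eq_bigr => i _; rewrite mxE scaler_sumr; apply: eq_bigr => j /eqP cj.
by rewrite AX (l_conn j (s i)) // cs.
Qed.

(* In herm_vec coordinates the kernel becomes the intersection of the span Q of
   the blocks with the hyperplane T = {ev X = 0}, and 1 is in Q but not in T. *)
Lemma rank_ker_info :
  ((\rank (kermx (classical_info - quantum_info))).+1 = g)%N.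
Proof.
set K := kermx _; pose T := herm_rows L; pose Q := herm_rows P.
pose e := herm_vec (1%:M : 'M[C]_d).
have herm1 : (1%:M : 'M[C]_d)^t* = 1%:M by rewrite trmx1 map_mx1.
have hermP i : (P i)^t* = P i.
  apply/matrixP => x y; rewrite !mxE !summxE rmorph_sum; apply: eq_bigr => j _.
  by rewrite -[in RHS]hermA !mxE.
have T_free : row_free T by exact: herm_rows_free.
have Q_free : row_free Q.
  apply: herm_rows_free => // z z0; apply/rowP => i; rewrite mxE.
  have [j <-] := c_surj i; have := mul_comb_block j z; rewrite z0 mulmx0.
  move/esym/eqP; rewrite scaler_eq0 (negPf (A0 j)) orbF => /eqP.
  exact: (@complexI _ _ 0).
(* The L_a and 1 are independent: if sum_a y_a L_a + t 1 = 0, applying ev leaves t = 0, because ev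
   L_a = 0 and ev 1 = 1. By [dimL] they fill all d * d coordinates. *)
have Te_free : row_free (col_mx T e).
  apply: row_free_ker => v; rewrite -[v]hsubmxK mul_row_col.
  move: (lsubmx v) (rsubmx v) => y t.
  have -> : t *m e = herm_vec ((t 0 0)%:C%:M).
    rewrite [t]mx11_scalar mul_scalar_mx mxE eqxx mulr1n; apply: (can_inj vec_mxK).
    rewrite linearZ /= !mxvecK; apply/matrixP => i j; rewrite !mxE.
    by case: (i == j); rewrite !(mulr1n, mulr0n) /= ?addr0 ?mulr0 ?mulr1.
  rewrite -herm_vec_comb => /eqP; rewrite addr_eq0 => /eqP yt.
  have : real_comb y L = (- t 0 0)%:C%:M.
    apply: herm_vec_inj.
    - exact: real_comb_herm.
    - rewrite tr_scalar_mx map_scalar_mx; congr (_%:M); exact: conjc_real.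
    rewrite yt; apply: (can_inj vec_mxK); rewrite linearN /= !mxvecK.
    apply/matrixP => i j; rewrite !mxE.
    by case: (i == j); rewrite !(mulr1n, mulr0n) /= ?addr0 ?oppr0 ?addr0.
  have [t0|t0 yL] := eqVneq (t 0 0) 0.
    rewrite t0 oppr0 => yL0; have -> : y = 0.
      by apply: L_free; rewrite yL0; apply/matrixP => i j; rewrite !mxE mul0rn.
    by rewrite (_ : t = 0) ?row_mx0 //; apply/matrixP => i j; rewrite !ord1 t0 mxE.
  have : ev (real_comb y L *m 1%:M) = 0.
    rewrite expectation_comb_l big1 // => a _.
    by rewrite mulmx1 trL mulr0.
  rewrite mulmx1 yL -scalemx1 expectationZ /ev mulmx1 tr_rho mulr1 => /eqP.
  by rewrite oppr_eq0 (negPf t0).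
have rT : \rank T = n by exact/eqP.
have rQ : \rank Q = g by exact/eqP.
have rTe : \rank (col_mx T e) = (d * d)%N by exact: etrans (eqP Te_free) dimL.
have eQ : (e <= Q)%MS.
  have [|z eE] := @eigen_comb_block 1%:M (fun=> 1) herm1.
    by move=> j; rewrite mulmx1 scale1r.
  by rewrite /e eE herm_vec_comb submxMl.
have rQT : \rank (Q + T)%MS = (d * d)%N.
  apply/eqP; rewrite eqn_leq rank_leq_col -{1}rTe mxrankS // col_mx_sub.
  by rewrite addsmxSr (submx_trans eQ (addsmxSl _ _)).
(* The free matrix T maps the kernel isomorphically onto the intersection, by [ker_infoP] and
   [eigen_comb_block]. *)
have rK : \rank (Q :&: T)%MS = \rank K.
  rewrite -(mxrankMfree K T_free); apply: eqmx_rank; apply/andP; split.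
    apply/rV_subP => v; rewrite sub_capmx => /andP[/submxP[z ->] /submxP[y zy]].
    have zyE : real_comb y L = real_comb z P.
      apply: herm_vec_inj; [exact: real_comb_herm|exact: real_comb_herm|].
      by rewrite !herm_vec_comb.
    rewrite zy submxMr //; apply/sub_kermxP/ker_infoP.
    by exists (fun j => z 0 (c j)) => j; rewrite zyE mul_comb_block.
  apply/rV_subP => v /submxP[w ->]; rewrite mulmxA; set y := w *m K.
  have /ker_infoP[l /eigen_comb_block[|z yE]] :
      y *m (classical_info - quantum_info) = 0.
  - by rewrite -mulmxA mulmx_ker mulmx0.
  - exact: real_comb_herm.
  by rewrite sub_capmx submxMl andbT -herm_vec_comb yE herm_vec_comb submxMl.
(* The dimension formula reads (n + 1) + rank K = g + n. *)
have := mxrank_sum_cap Q T; rewrite rQT rK rT rQ -dimL addnC.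
by rewrite [in RHS]addnC addnA [(_ + n)%N]addnC -addnA => /addnI; rewrite addn1.
Qed.

End Count.
End Measurement.
End Information.

(** * The adjusted matrix, logarithmic derivatives and parameter derivatives *)

Lemma pd_unitmx (F : numFieldType) (theta : {rmorphism F -> F}) n (J : 'M[F]_n) :
  pdmx theta J -> J \in unitmx.
Proof.
move=> [_ J_gt0]; rewrite -row_free_unit; apply: row_free_ker => y yJ.
by apply/eqP/negPn/negP => /J_gt0; rewrite /form yJ mul0mx mxE ltxx.
Qed.

(** Subtracting 1 from S^-1 X S^-1 gives S^-1 (X - S S) S^-1, and invertible factors preserve rank.
    It is applied with S the square root of the quantum information. *)
Lemma rank_eigenspace_congr (F : fieldType) n (X S : 'M[F]_n) :
  S \in unitmx ->
  \rank (eigenspace (invmx S *m X *m invmx S) 1) =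
  \rank (kermx (X - S *m S)).
Proof.
move=> uS; rewrite /eigenspace !mxrank_ker.
have -> : invmx S *m X *m invmx S - 1%:M =
    invmx S *m (X - S *m S) *m invmx S.
  by rewrite mulmxBr mulmxBl mulmxA mulVmx // mul1mx mulmxV.
rewrite mxrankMfree ?row_free_unit ?unitmx_inv // eqmxMfull //.
by rewrite row_full_unit unitmx_inv.
Qed.

Section Parametrized.
Local Open Scope sesquilinear_scope.
Variables (R : realType) (d : nat).
Local Notation C := R[i].

Lemma half_complex : (2^-1 : C) = (2^-1)%:C.
Proof. by rewrite fmorphV rmorph_nat. Qed.

(** Existence comes from [lyapunov_surj], the factor 2 offsetting the half in [sld]. The solution is
    Hermitian because L - L^* solves the homogeneous equation. *)
Lemma sldP (P X : 'M[C]_d) : pdmx Num.conj P -> X^t* = X ->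
  (sld P X)^t* = sld P X /\ 2^-1 *: (P *m sld P X + sld P X *m P) = X.
Proof.
move=> pdP hX; rewrite /sld; case: xgetP => [L _ [/hermsymmxP hL LE] //|/= noL].
have [L LE] := lyapunov_surj (2 *: X) pdP.
have hP : P^t* = P by apply/hermsymmxP; case: pdP.
have hL : L^t* = L.
  apply/subr0_eq/(lyapunov_eq0 pdP).
  rewrite mulmxBr mulmxBl addrACA -opprD LE addrC; apply/eqP.
  rewrite addrC subr_eq0 -{1}hP -{2}hP -!adjmxM addrC -map_mxD -linearD LE.
  rewrite /= linearZ /= map_mxZ hX; apply/eqP; congr (_ *: _).
  by rewrite rmorph_nat.
case: (noL L); split; first exact/hermsymmxP.
by rewrite LE scalerA mulVf ?scale1r // pnatr_eq0.
Qed.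

(** The two halves of the anticommutator have conjugate traces against X. With X = A_j this yields
    the derivative of p_j, with X = 1 that ev L = 0. *)
Lemma expectation_sld (P L X : 'M[C]_d) : P^t* = P -> L^t* = L -> X^t* = X ->
  complex.Re (\tr (2^-1 *: (P *m L + L *m P) *m X)) = expectation P (L *m X).
Proof.
move=> hP hL hX; rewrite -scalemxAl mxtraceZ half_complex ReZ mulmxDl mxtraceD ReD.
have LPX : complex.Re (\tr (L *m P *m X)) = complex.Re (\tr (P *m L *m X)).
  rewrite -Re_conj -mxtrace_adj !adjmxM hP hL hX mxtrace_mulC.
  by rewrite -(mulmxA P).
rewrite [X in _ + X]LPX /expectation mulmxA.
by move: (complex.Re _) => x; lra.
Qed.

Lemma expectation_anticomm (P X Y : 'M[C]_d) :
  pdmx Num.conj P -> X^t* = X -> Y^t* = Y ->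
  complex.Re (2^-1 * \tr (P *m (X *m Y + Y *m X))) = expectation P (X *m Y).
Proof.
move=> pdP hX hY; rewrite half_complex ReZ mulmxDr mxtraceD ReD.
have YX : complex.Re (\tr (P *m (Y *m X))) = complex.Re (\tr (P *m (X *m Y))).
  exact: expectationC.
rewrite [X in _ + X]YX /expectation.
by move: (complex.Re _) => x; lra.
Qed.

Variables (rho : 'rV[R]_(nparam d) -> 'M[C]_d) (t : 'rV[R]_(nparam d)).
Hypothesis rho_diff : differentiable_family rho t.

(** The trace is a real linear combination of the real and imaginary parts of the entries of rho, so
    it is differentiated termwise. *)
Lemma derive_Re_tr (X : 'M[C]_d) a :
  'D_('e_a) (fun s => complex.Re (\tr (rho s *m X))) t =
  complex.Re (\tr (pderiv rho a t *m X)).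
Proof.
pose f i k s := complex.Re (rho s i k * X k i).
have fE : (fun s => complex.Re (\tr (rho s *m X))) = \sum_i \sum_k f i k.
  apply/funext => s; rewrite fct_sumE Re_sum; apply: eq_bigr => i _.
  by rewrite fct_sumE mxE Re_sum.
have df i k : is_derive t 'e_a (f i k) (complex.Re (pderiv rho a t i k * X k i)).
  have [dRe dIm] := rho_diff i k.
  have Re_d := is_deriveZ (complex.Re (X k i))
    (derivableP (diff_derivable (v := 'e_a) dRe)).
  have Im_d := is_deriveZ (complex.Im (X k i))
    (derivableP (diff_derivable (v := 'e_a) dIm)).
  have := is_deriveB Re_d Im_d.
  have -> : f i k = complex.Re (X k i) \*: (fun s => complex.Re (rho s i k)) -
                    complex.Im (X k i) \*: (fun s => complex.Im (rho s i k)).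
    apply/funext => s; transitivity (complex.Re (X k i) * complex.Re (rho s i k) -
      complex.Im (X k i) * complex.Im (rho s i k)); last by [].
    rewrite /f; case: (rho s i k) (X k i) => [x y] [z w] /=.
    by rewrite [z * x]mulrC [w * y]mulrC.
  rewrite [pderiv _ _ _ _ _]mxE; case: (X k i) => [z w] /=.
  by rewrite [z *: _]mulrC [w *: _]mulrC.
have := is_derive_sum (fun i => is_derive_sum (df i)).
rewrite -fE => /@derive_val ->; rewrite Re_sum; apply: eq_bigr => i _.
by rewrite mxE Re_sum.
Qed.

Hypothesis rho_near : \forall s \near t, density (rho s).

(** rho is Hermitian on a neighbourhood of t, and derivatives at t depend only on the values
    there. *)
Lemma pderiv_herm a : (pderiv rho a t)^t* = pderiv rho a t.
Proof.
have hE : \forall s \near t, (rho s)^t* = rho s.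
  by near=> s; apply/hermsymmxP; case: (near rho_near s) => // -[].
apply/matrixP => i j; rewrite !mxE.
rewrite -[LHS]/(_ -i* _); congr (_ +i* _).
  by apply: near_eq_derive; near=> s; rewrite -[in RHS](near hE s) // !mxE Re_conj.
rewrite -deriveN; last by apply: diff_derivable; case: (rho_diff j i).
apply: near_eq_derive; near=> s; rewrite -[in RHS](near hE s) // !mxE.
by rewrite fctE; case: (rho s j i).
Unshelve. all: by end_near. Qed.

Lemma pderiv_tr a : complex.Re (\tr (pderiv rho a t)) = 0.
Proof.
rewrite -[pderiv _ _ _]mulmx1 -derive_Re_tr -[RHS](derive_cst (1 : R) t 'e_a).
apply: near_eq_derive; near=> s; rewrite mulmx1.
by have [_ ->] : density (rho s) by near: s.
Unshelve. all: by end_near. Qed.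

End Parametrized.

(** Expanding tr(A_j 1) over the elements gives tr A_j from the term i = j plus nonnegative terms,
    all of which must vanish. *)
Lemma pvm_orth (C : numClosedFieldType) d (I : finType) (A : I -> 'M[C]_d) :
  (forall j, psdmx Num.conj (A j)) -> \sum_j A j = 1%:M ->
  (forall j, A j *m A j = A j) ->
  forall j k, j != k -> \tr (A j *m A k) = 0.
Proof.
move=> psdA sumA idA j k jk.
have tr_ge0 i : 0 <= \tr (A j *m A i) by exact: psdmx_tr_mul_ge0.
have : \tr (A j) = \sum_i \tr (A j *m A i).
  by rewrite -{1}[A j]mulmx1 -sumA mulmx_sumr raddf_sum.
rewrite (bigD1 j) //= idA -[LHS]addr0 => /addrI/esym/eqP.
rewrite psumr_eq0 // => /allP/(_ k (mem_index_enum _)).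
by rewrite eq_sym jk => /eqP.
Qed.

(** * The sharpness index as a component count, and the case of equality *)

Theorem theorem1 (R : realType) (d : nat) (I : finType) (A : I -> 'M[R[i]]_d)
    (simpleA : simple_povm A) (rho0 : 'M[R[i]]_d) (rho0D : density rho0)
    (rho : 'rV[R]_(nparam d) -> 'M[R[i]]_d) (theta : 'rV[R]_(nparam d))
    (rho_param : parametrization_near rho theta) (rho_theta : rho theta = rho0) :
  [/\ (sharpness_index rho A theta)%:Z = (projective_index A)%:Z - 1,
      (projective_index A)%:Z - 1 <= d%:Z - 1
    & (sharpness_index rho A theta)%:Z = d%:Z - 1 <-> rank1 A /\ pvm A].
Proof.
have [[psdA sumA] A0 freeA] := simpleA; have [pd0 tr0] := rho0D.
have hermA j : map_mx Num.conj (A j)^T = A j by apply/hermsymmxP; case: (psdA j).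
have herm0 : map_mx Num.conj rho0^T = rho0 by apply/hermsymmxP; case: pd0.
have [_ rho_diff rho_indep] := nbhs_singleton rho_param.
have rho_near : \forall s \near theta, density (rho s).
  by apply: filterS rho_param => s [].
(* Trace 1 excludes d = 0, where the subtraction in [nparam] would be truncated. *)
have d_gt0 : (0 < d)%N.
  rewrite lt0n; apply/eqP => d0; have := tr0.
  rewrite /mxtrace big1 => [/esym/eqP|i _]; first by rewrite oner_eq0.
  by have := ltn_ord i; rewrite {2}d0.
have A_herm j : A j \is hermsymmx by apply/hermsymmxP.
have [c [c_surj c_orth c_conn]] := transition_components A0 A_herm.
pose L a := sld rho0 (pderiv rho a theta).
have LP a := sldP pd0 (pderiv_herm rho_diff rho_near a).
have hermL a : map_mx Num.conj (L a)^T = L a by case: (LP a).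
have LE a : 2^-1 *: (rho0 *m L a + L a *m rho0) = pderiv rho a theta by case: (LP a).
have evL a X : map_mx Num.conj X^T = X ->
    complex.Re (\tr (pderiv rho a theta *m X)) = expectation rho0 (L a *m X).
  by move=> hX; rewrite -LE expectation_sld.
have evL0 a : expectation rho0 (L a) = 0.
  rewrite -[L a]mulmx1 -evL ?trmx1 ?map_mx1 // mulmx1.
  exact: (pderiv_tr rho_diff rho_near).
(* The map X |-> (rho0 X + X rho0) / 2 carries a relation among the L_a to one among the derivatives
   of rho. *)
have L_free y : real_comb y L = 0 -> y = 0.
  move=> yL; apply/rowP => a; rewrite mxE; apply: (rho_indep (fun a => y 0 a)) => //.
  transitivity (2^-1 *: (rho0 *m real_comb y L + real_comb y L *m rho0)).
    rewrite /real_comb mulmx_sumr mulmx_suml -big_split scaler_sumr.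
    apply: eq_bigr => b _ /=; rewrite -LE -scalemxAr -scalemxAl -scalerDr.
    by rewrite !scalerA mulrC.
  by rewrite yL mulmx0 mul0mx addr0 scaler0.
have dimL : (nparam d + 1 = d * d)%N.
  by rewrite /nparam subnK ?mulnn // expn_gt0 d_gt0.
have qE : qfisher rho theta = quantum_info rho0 L.
  apply/matrixP => a b; rewrite !mxE rho_theta -/(L a) -/(L b).
  exact: expectation_anticomm.
have dprob j a : 'D_('e_a) (prob rho A j) theta = expectation rho0 (L a *m A j).
  by rewrite derive_Re_tr // evL.
have fE : fisher rho A theta = classical_info rho0 A L.
  apply/matrixP => a b; rewrite !mxE; apply: eq_big => j; first exact: A0.
  by rewrite !dprob /prob rho_theta.
have rankE : ((sharpness_index rho A theta).+1 = projective_index A)%N.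
  have pdJ := quantum_info_pd pd0 hermL L_free.
  rewrite /sharpness_index /metric_adjusted_fisher qE fE.
  have SS := sqrtmxK pdJ.
  rewrite rank_eigenspace_congr ?SS; last first.
    by have := pd_unitmx pdJ; rewrite -{1}SS unitmx_mul => /andP[].
  exact: rank_ker_info c_surj c_orth c_conn.
have le_d := blocks_le psdA sumA c_surj c_orth A0.
(* By [rankE], saturation of the bound amounts to gamma = d. If so, [c] is injective and each
   element is a rank-1 block, hence a projector. *)
have gE : projective_index A = d <-> rank1 A /\ pvm A.
  split=> [gd|[r1 [_ idA]]].
    have c_inj := blocks_full_inj psdA sumA c_surj c_orth A0 gd freeA.
    split; first by move=> j _; rewrite -(block_inj A j c_inj); exact: blocks_rank1.
    split=> // j; split=> //; rewrite -(block_inj A j c_inj).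
    by rewrite mul_block // eqxx.
  (* Distinct elements of a PVM are orthogonal, so the identity function is constant along edges and
     components are singletons. The ranks, all 1, then sum both to gamma and to d. *)
  have c_inj : injective c.
    move=> j k; apply: (c_conn _ id) => {}j {}k; apply: contraNeq => jk.
    by apply/eqP; apply: pvm_orth => // i; case: (idA i).
  apply: etrans (sum_rank_block psdA sumA c_orth).
  rewrite -[LHS]card_ord -sum1_card.
  apply: eq_bigr => i _; have [j <-] := c_surj i.
  by rewrite block_inj // r1.
by split; [lia|lia|rewrite -gE; lia].
Qed.
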